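(* Let $S\subseteq\mathbb{N}^d$ be a simplicial affine semigroup with extremal rays $\mathbf{a}_1,\dots,\mathbf{a}_d$ and let $E=\{\mathbf{a}_1,\dots,\mathbf{a}_d\}$. The following statements are equivalent. (1) $S$ is normal; (2) $-\operatorname{QF}(S)\subseteq S\cap\operatorname{relint}(S)$; (3) $-\operatorname{QF}(S)\subseteq\operatorname{relint}(S)$; (4) $\operatorname{Ap}(S,E)\subseteq P_S$.
   Context: $\mathbb{N}$ denotes the nonnegative integers and $d\ge 1$. An affine semigroup is a finitely generated submonoid $S$ of $\mathbb{N}^d$; it has a unique minimal generating set $\operatorname{mgs}(S)$. $S$ is simplicial if there are $d$ elements of $\operatorname{mgs}(S)$, linearly independent over $\mathbb{Q}$, such that every $\mathbf{a}\in S$ has a positive multiple $n\mathbf{a}$ that is an $\mathbb{N}$-linear combination of these $d$ elements. Equivalently, $\operatorname{cone}(S)$, the set of nonnegative real combinations of elements of $S$, has exactly $d$ one-dimensional extremal rays. The smallest nonzero element of $S$ on each of these rays is called an extremal ray of $S$; these are $\mathbf{a}_1,\dots,\mathbf{a}_d$, and they form a basis of $\mathbb{R}^d$ and span $\operatorname{cone}(S)$. $P_S=\{\sum_{i=1}^d\lambda_i\mathbf{a}_i : 0\le\lambda_i<1 \text{ for all } i\}$. $\operatorname{relint}(S)=\{\sum_{i=1}^d\lambda_i\mathbf{a}_i : \lambda_i\in\mathbb{R}_{>0}\text{ for all } i\}$ is the relative interior of $\operatorname{cone}(S)$. $\operatorname{group}(S)=\{\mathbf{a}-\mathbf{b} :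 \mathbf{a},\mathbf{b}\in S\}$; the normalization of $S$ is $\bar S=\operatorname{group}(S)\cap\operatorname{cone}(S)$, and $S$ is normal if $S=\bar S$. $\operatorname{Ap}(S,E)=\{\mathbf{a}\in S : \mathbf{a}-\mathbf{a}_i\notin S \text{ for all } i=1,\dots,d\}$, which is a finite set. The partial order $\preceq_S$ is: $\mathbf{x}\preceq_S\mathbf{y}$ iff $\mathbf{y}-\mathbf{x}\in S$. $\operatorname{QF}(S)=\{\mathbf{w}-\sum_{i=1}^d\mathbf{a}_i : \mathbf{w}\in\max_{\preceq_S}\operatorname{Ap}(S,E)\}$, where $\max_{\preceq_S}$ denotes the set of maximal elements, and $-\operatorname{QF}(S)=\{-\mathbf{f} : \mathbf{f}\in\operatorname{QF}(S)\}$. *)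

(* Defs.v *)
From mathcomp Require Import all_boot all_order all_algebra.
From mathcomp Require Import boolp classical_sets functions cardinality reals.

Set Implicit Arguments.
Unset Strict Implicit.
Unset Printing Implicit Defensive.

Import Order.TTheory GRing.Theory Num.Theory.
Local Open Scope classical_set_scope.
Local Open Scope ring_scope.

(* N^d, Z^d and Q^d are all viewed inside the single ambient space R^d, so that
   S, group(S), cone(S), relint(S), P_S, Ap(S, E) and QF(S) are all subsets of
   the same type and can be intersected and compared literally. *)

Section AffineSemigroups.
Variables (R : realType) (d : nat).
Local Notation V := 'rV[R]_d.
Implicit Types (S A B C G rho : set V) (a g : 'I_d -> V).

Definition nat_vectors : set V := [set x | forall j, x ord0 j \is a Num.nat].

Definition nat_span G : set V :=
  [set x | exists (n : nat) (c : 'I_n -> nat) (v : 'I_n -> V),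
     (forall i, G (v i)) /\ x = \sum_(i < n) v i *+ c i].

Definition affine_semigroup S : Prop :=
  S `<=` nat_vectors /\ exists2 G, finite_set G & nat_span G = S.

Definition minimal_generating_set S B : Prop :=
  nat_span B = S /\ forall C, C `<=` B -> nat_span C = S -> C = B.

Definition linearly_independent_over_rat g : Prop :=
  forall c : 'I_d -> rat,
    \sum_(i < d) ratr (c i) *: g i = 0 -> forall i, c i = 0.

(* The minimal generating set of an affine semigroup is unique, so B below is
   mgs(S). *)
Definition simplicial S : Prop :=
  exists2 B, minimal_generating_set S B &
    exists g, [/\ forall i, B (g i),
      linearly_independent_over_rat g &
      forall x, S x -> exists (n : nat) (c : 'I_d -> nat),
        (0 < n)%N /\ x *+ n = \sum_(i < d) g i *+ c i].

Definition cone S : set V :=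
  [set x | exists (n : nat) (c : 'I_n -> R) (v : 'I_n -> V),
     [/\ forall i, S (v i), forall i, 0 <= c i &
         x = \sum_(i < n) c i *: v i]].

Definition ray (v : V) : set V := [set t *: v | t in [set t : R | 0 <= t]].

(* One-dimensional faces of the convex cone C. *)
Definition cone_extremal_ray C rho : Prop :=
  [/\ exists2 v, v != 0 & rho = ray v,
      rho `<=` C &
      forall x y, C x -> C y -> rho (x + y) -> rho x /\ rho y].

(* Two elements of S on a common ray are comparable componentwise. *)
Definition extremal_rays S : set V :=
  [set a | exists2 rho, cone_extremal_ray (cone S) rho &
     [/\ S a, a != 0, rho a &
         forall b, S b -> b != 0 -> rho b ->
           forall j, a ord0 j <= b ord0 j]].

Definition fundamental_parallelepiped a : set V :=
  [set x | exists2 l : 'I_d -> R, (forall i, 0 <= l i < 1) &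
     x = \sum_(i < d) l i *: a i].

Definition relint a : set V :=
  [set x | exists2 l : 'I_d -> R, (forall i, 0 < l i) &
     x = \sum_(i < d) l i *: a i].

Definition group_of S : set V :=
  [set x | exists u v, [/\ S u, S v & x = u - v]].

Definition normalization S : set V := group_of S `&` cone S.

Definition normal_semigroup S : Prop := S = normalization S.

Definition apery S a : set V := [set x | S x /\ forall i, ~ S (x - a i)].

Definition semigroup_le S (x y : V) : Prop := S (y - x).

Definition maximal_elements S A : set V :=
  [set w | A w /\ forall y, A y -> semigroup_le S w y -> y = w].

Definition quasi_frobenius S a : set V :=
  [set w - \sum_(i < d) a i | w in maximal_elements S (apery S a)].

Definition opp_set A : set V := [set - f | f in A].

End AffineSemigroups.

(* Main.v *)
Require Import Defs.
From mathcomp Require Import all_boot all_order all_algebra.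
From mathcomp Require Import boolp classical_sets functions cardinality reals.

Set Implicit Arguments.
Unset Strict Implicit.
Unset Printing Implicit Defensive.

Import Order.TTheory GRing.Theory Num.Theory.
Local Open Scope classical_set_scope.
Local Open Scope ring_scope.

(** In a simplicial semigroup the extremal rays a_1, ..., a_d are a basis of
    R^d, every element of S has a positive multiple in the N-span of the a_i,
    and every element of S is an Apery element plus an N-combination of the
    a_i. Hence every element of group(S) is an Apery element plus a
    Z-combination of the a_i, and when Ap(S, E) lies in P_S such an element is
    in the cone only if the integer coefficients are nonnegative: this is
    normality. Conversely, an Apery element w with a coordinate l_i >= 1 would
    give w - a_i in the normalization but not in S. For w maximal in Ap(S, E),
    the opposite of the quasi-Frobenius element has coordinates 1 - l_i, so
    being in the relative interior means l_i < 1; since Ap(S, E) is bounded,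
    every Apery element lies below a maximal one, whose coordinates dominate. *)

(** * Submonoids and N-spans *)

Definition submonoid (V : zmodType) (S : set V) : Prop :=
  S 0 /\ forall x y, S x -> S y -> S (x + y).

Definition linearly_independent (R : realType) (d : nat)
    (a : 'I_d -> 'rV[R]_d) : Prop :=
  forall l : 'I_d -> R, \sum_i l i *: a i = 0 -> forall i, l i = 0.

Definition spans_up_to_multiple (R : realType) (d : nat)
    (S : set 'rV[R]_d) (a : 'I_d -> 'rV[R]_d) : Prop :=
  forall x, S x -> exists (n : nat) (c : 'I_d -> nat),
    (0 < n)%N /\ x *+ n = \sum_i a i *+ c i.

(** An additive size function, at least 1 on nonzero vectors of N^d. It makes descent and ascent
    inside S terminate. *)
Definition coord_sum (R : realType) (d : nat) (x : 'rV[R]_d) : R :=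
  \sum_j x ord0 j.

Lemma submonoid_mulrn (V : zmodType) (S : set V) :
  submonoid S -> forall x n, S x -> S (x *+ n).
Proof.
move=> [S0 SD] x n Sx; elim: n => [|n IHn]; first by rewrite mulr0n.
by rewrite mulrS; apply: SD.
Qed.

Lemma submonoid_sum (V : zmodType) (S : set V) :
  submonoid S -> forall (I : eqType) (s : seq I) (P : pred I) (F : I -> V),
  {in s, forall i, P i -> S (F i)} -> S (\sum_(i <- s | P i) F i).
Proof.
move=> [S0 SD] I s P F SF; rewrite big_seq_cond.
by apply: big_ind => // i /andP[si Pi]; apply: SF.
Qed.

Lemma submonoid_nat_comb (V : zmodType) (S : set V) (I : finType)
    (a : I -> V) (c : I -> nat) :
  submonoid S -> (forall i, S (a i)) -> S (\sum_i a i *+ c i).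
Proof.
by move=> mS Sa; apply: submonoid_sum => // i _ _; apply: submonoid_mulrn.
Qed.

Lemma nat_span_sub (R : realType) (d : nat) (G : set 'rV[R]_d) :
  G `<=` nat_span G.
Proof.
move=> x Gx; exists 1%N, (fun=> 1%N), (fun=> x); split=> //.
by rewrite big_ord1.
Qed.

Lemma nat_span_submonoid (R : realType) (d : nat) (G : set 'rV[R]_d) :
  submonoid (nat_span G).
Proof.
split.
  by exists 0%N, (fun=> 0%N), (fun=> 0); split=> [[]//|]; rewrite big_ord0.
move=> x y [m [c [v [Gv ->]]]] [n [e [w [Gw ->]]]].
exists (m + n)%N,
  (fun i => match fintype.split i with inl j => c j | inr j => e j end),
  (fun i => match fintype.split i with inl j => v j | inr j => w j end).
split=> [i|]; first by case: (fintype.split i).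
rewrite big_split_ord /=; congr (_ + _); apply: eq_bigr => i _.
  by rewrite -[lshift n i]/(unsplit (inl i)) unsplitK.
by rewrite -[rshift m i]/(unsplit (inr i)) unsplitK.
Qed.

(** Collecting repeated generators leaves one coefficient per generator; [apery_bounded] bounds
    these one at a time. *)
Lemma nat_span_seq (R : realType) (d : nat) (s : seq 'rV[R]_d)
    (x : 'rV[R]_d) :
  uniq s -> nat_span [set` s] x ->
  exists c : 'rV[R]_d -> nat, x = \sum_(v <- s) v *+ c v.
Proof.
move=> us [n [c [v [sv ->]]]].
exists (fun u => \sum_(i < n | v i == u) c i)%N.
under [RHS]eq_bigr do rewrite -sumrMnr big_mkcond.
rewrite exchange_big /=; apply: eq_bigr => i _.
rewrite (bigD1_seq (v i)) ?eqxx //=; last exact: sv.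
rewrite big1 ?addr0 // => u; rewrite eq_sym => /negbTE ->.
by [].
Qed.

(** * The coordinate sum on N^d *)

Lemma coord_sumD (R : realType) (d : nat) (x y : 'rV[R]_d) :
  coord_sum (x + y) = coord_sum x + coord_sum y.
Proof. by rewrite -big_split; apply: eq_bigr => j _; rewrite mxE. Qed.

Lemma coord_sumN (R : realType) (d : nat) (x : 'rV[R]_d) :
  coord_sum (- x) = - coord_sum x.
Proof. by rewrite -sumrN; apply: eq_bigr => j _; rewrite mxE. Qed.

Lemma coord_sum0 (R : realType) (d : nat) : coord_sum (0 : 'rV[R]_d) = 0.
Proof. by apply: big1 => j _; rewrite mxE. Qed.

Lemma coord_sum_sum (R : realType) (d : nat) (I : Type) (s : seq I)
    (F : I -> 'rV[R]_d) :
  coord_sum (\sum_(i <- s) F i) = \sum_(i <- s) coord_sum (F i).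
Proof. exact: (big_morph _ (@coord_sumD R d) (coord_sum0 R d)). Qed.

Lemma coord_sumMn (R : realType) (d : nat) (x : 'rV[R]_d) n :
  coord_sum (x *+ n) = coord_sum x *+ n.
Proof.
by elim: n => [|n IHn]; rewrite ?mulr0n ?coord_sum0 // !mulrS coord_sumD IHn.
Qed.

Lemma coord_sum_ge0 (R : realType) (d : nat) (x : 'rV[R]_d) :
  nat_vectors x -> 0 <= coord_sum x.
Proof. by move=> Nx; apply: sumr_ge0 => j _; apply: natr_ge0. Qed.

Lemma coord_sum_ge1 (R : realType) (d : nat) (x : 'rV[R]_d) :
  nat_vectors x -> x != 0 -> 1 <= coord_sum x.
Proof.
move=> Nx /rV0Pn[j xj].
rewrite /coord_sum (bigD1 j) //= -[1]addr0 lerD //.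
  by have /natrP[[|n] e] := Nx j; rewrite e ?ler1n // in xj *; rewrite eqxx in xj.
by apply: sumr_ge0 => k _; apply: natr_ge0.
Qed.

(** * Linear independence and coordinates in the cone *)

Lemma linearly_independent_inj (R : realType) (d : nat)
    (a : 'I_d -> 'rV[R]_d) (l m : 'I_d -> R) :
  linearly_independent a -> \sum_i l i *: a i = \sum_i m i *: a i -> l =1 m.
Proof.
move=> fa e i; apply/eqP; rewrite -subr_eq0; apply/eqP.
apply: (fa (fun i => l i - m i)).
under eq_bigr do rewrite scalerBl.
by rewrite sumrB e subrr.
Qed.

(** Matrix rank is invariant under field extension, and natural entries make the matrix of the [g i]
    rational. *)
Lemma linearly_independent_over_reals (R : realType) (d : nat)
    (g : 'I_d -> 'rV[R]_d) :
  (forall i, nat_vectors (g i)) -> linearly_independent_over_rat g ->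
  linearly_independent g.
Proof.
move=> Ng fg l lg0 i.
pose M : 'M[rat]_d := \matrix_(i, j) (Num.truncn (g i ord0 j))%:R.
have ME i' j : ratr (M i' j) = g i' ord0 j.
  by rewrite mxE ratr_nat; apply: truncK; apply: Ng.
have fM : row_free M.
  apply: inj_row_free => v vM0; apply/rowP => k; rewrite mxE.
  apply: (fg (v ord0)); apply/rowP => j; rewrite summxE mxE.
  transitivity (ratr ((v *m M) ord0 j) : R); last by rewrite vM0 mxE rmorph0.
  by rewrite mxE rmorph_sum; apply: eq_bigr => k' _; rewrite mxE rmorphM /= ME.
have fMR : row_free (map_mx (@ratr R) M) by rewrite /row_free mxrank_map.
have lM0 : \row_k l k *m map_mx ratr M = 0.
  rewrite -lg0; apply/rowP => j; rewrite summxE mxE.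
  by apply: eq_bigr => k _; rewrite [map_mx _ _ _ _]mxE ME !mxE.
have /rowP/(_ i) : \row_k l k = 0 by apply: (row_free_inj fMR); rewrite mul0mx.
by rewrite !mxE.
Qed.

Lemma cone_nonneg_comb (R : realType) (d : nat) (S : set 'rV[R]_d)
    (a : 'I_d -> 'rV[R]_d) (x : 'rV[R]_d) :
  spans_up_to_multiple S a -> cone S x ->
  exists2 l : 'I_d -> R, forall i, 0 <= l i & x = \sum_i l i *: a i.
Proof.
move=> spS [n [c [v [Sv c0 ->]]]].
apply: (big_ind (fun x => exists2 l : 'I_d -> R, forall i, 0 <= l i &
  x = \sum_i l i *: a i)).
- by exists (fun=> 0) => //; rewrite big1 // => i _; rewrite scale0r.
- move=> y z [l l0 ->] [m m0 ->]; exists (fun i => l i + m i).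
    by move=> i; apply: addr_ge0.
  by rewrite -big_split; apply: eq_bigr => i _; rewrite scalerDl.
move=> k _; have [p [e [p0 ep]]] := spS _ (Sv k).
exists (fun i => c k * (p%:R^-1 * (e i)%:R)).
  by move=> i; rewrite !mulr_ge0 ?invr_ge0.
under eq_bigr do rewrite -!scalerA scaler_nat.
rewrite -!scaler_sumr -ep -scaler_nat [_^-1 *: _]scalerA mulVf ?scale1r //.
by rewrite pnatr_eq0 -lt0n.
Qed.

Lemma sub_cone (R : realType) (d : nat) (S : set 'rV[R]_d) : S `<=` cone S.
Proof.
move=> x Sx; exists 1%N, (fun=> 1), (fun=> x); split=> //.
by rewrite big_ord1 scale1r.
Qed.

(** * Extremal rays form a basis *)

(** Some term [l i *: g i] of [b] is nonzero, and extremality puts it on the ray of [b]. Hence this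
    ray is spanned by [g i], and the minimality of [b] can be stated along [g i]. *)
Lemma extremal_ray_generator (R : realType) (d : nat) (S : set 'rV[R]_d)
    (g : 'I_d -> 'rV[R]_d) (b : 'rV[R]_d) :
  (forall i, S (g i)) -> spans_up_to_multiple S g -> extremal_rays S b ->
  exists (i : 'I_d) (t : R), [/\ 0 < t, b = t *: g i &
    forall t' : R, 0 <= t' -> S (t' *: g i) -> t' *: g i != 0 ->
      forall j, b ord0 j <= (t' *: g i) ord0 j].
Proof.
move=> Sg spS [rho [[v v0 rhoE] _ face] [Sb b0 rhob bmin]].
have [l l0 bE] := cone_nonneg_comb spS (sub_cone Sb).
have [i lgi] : exists i, l i *: g i != 0.
  apply/existsP; apply: contraNT b0 => /existsPn lg0.
  by rewrite bE big1 // => i _; have := lg0 i; rewrite negbK => /eqP.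
have coneg (m : 'I_d -> R) : (forall k, 0 <= m k) -> cone S (\sum_k m k *: g k).
  by move=> m0; exists d, m, g.
(* The face condition is applied to [b] split into its [i]-th term and the sum of the others, both
   in the cone. *)
have [] := face (l i *: g i) (b - l i *: g i).
- by exists 1%N, (fun=> l i), (fun=> g i); rewrite big_ord1.
- rewrite bE [X in X - _](bigD1 i) //= [X in cone S X]addrC addKr.
  rewrite (_ : \sum_(_ < _ | _) _ =
               \sum_k (if k != i then l k else 0) *: g k).
    by apply: coneg => k; case: ifP.
  by rewrite big_mkcond; apply: eq_bigr => k _; case: ifP; rewrite ?scale0r.
- by rewrite addrC subrK.
rewrite rhoE => -[t /= t0 tv] _.
have li0 : 0 < l i.
  by rewrite lt0r l0 andbT; apply: contraNneq lgi => ->; rewrite scale0r.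
have giE : g i = ((l i)^-1 * t) *: v.
  by rewrite -scalerA tv scalerA mulVf ?scale1r // gt_eqF.
have tgt0 : 0 < t.
  by rewrite lt0r t0 andbT; apply: contraNneq lgi => t_eq0;
     rewrite -tv t_eq0 scale0r.
move: (rhob); rewrite rhoE => -[u /= u0 uv].
have ugt0 : 0 < u.
  by rewrite lt0r u0 andbT; apply: contraNneq b0 => u_eq0;
     rewrite -uv u_eq0 scale0r.
(* From [b = u *: v] and [t *: v = l i *: g i]. *)
exists i, (u * (t^-1 * l i)); split.
- by rewrite !mulr_gt0 ?invr_gt0.
- rewrite giE scalerA -uv; congr (_ *: _).
  by rewrite -!mulrA mulVKf ?gt_eqF // mulVf ?mulr1 // gt_eqF.
- move=> t' t'0 St' nz; apply: bmin => //; rewrite rhoE giE scalerA.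
  by exists (t' * ((l i)^-1 * t)) => //=; rewrite !mulr_ge0 ?invr_ge0 // ltW.
Qed.

(** Each [a j] is a positive multiple of some [g (s j)], and [s] turns out to be a permutation.
    Independence is then a rescaling, and denominators are cleared to pass from [g] to [a]. *)
Lemma extremal_rays_basis (R : realType) (d : nat) (S : set 'rV[R]_d)
    (g a : 'I_d -> 'rV[R]_d) :
  (forall i, S (g i)) -> spans_up_to_multiple S g -> linearly_independent g ->
  injective a -> (forall i, extremal_rays S (a i)) ->
  linearly_independent a /\ spans_up_to_multiple S a.
Proof.
move=> Sg spS fg inj_a rays_a.
have Sa j : S (a j) by have [rho _ []] := rays_a j.
have a0 j : a j != 0 by have [rho _ []] := rays_a j.
have /choice[s /choice[t st]] :=
  fun j => extremal_ray_generator Sg spS (rays_a j).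
have t0 j : 0 < t j by have [] := st j.
have aE j : a j = t j *: g (s j) by have [] := st j.
have s_inj : injective s.
  (* Two minimal elements on the same ray bound each other coordinatewise, hence coincide. *)
  have le j k : s j = s k -> forall x, a j ord0 x <= a k ord0 x.
    move=> sjk x; have [_ _ mn] := st j.
    rewrite (aE k) -sjk; apply: mn; rewrite ?(ltW (t0 k)) // sjk -?aE //.
  move=> j k sjk; apply: inj_a; apply/rowP => x.
  by apply/eqP; rewrite eq_le !le.
have s_bij : bijective s := injF_bij s_inj.
have reidx (F : 'I_d -> 'rV[R]_d) : \sum_i F i = \sum_j F (s j).
  by rewrite (reindex s) //; apply: onW_bij.
split=> [l la0 j|].
  have [s' sK s'K] := s_bij.
  have : l j * t j = 0.
    rewrite -[j]sK; apply: (fg (fun i => l (s' i) * t (s' i))).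
    rewrite reidx -[RHS]la0; apply: eq_bigr => k _.
    by rewrite sK aE scalerA.
  by move/eqP; rewrite mulf_eq0 (gt_eqF (t0 j)) orbF => /eqP.
(* The factor [t j] is rational: comparing coordinates in [n] times [a j] gives
   [n * t j = c (s j)]. *)
have pq j : exists p q, (0 < p)%N /\ g (s j) *+ p = a j *+ q.
  have [n [c [n0 ac]]] := spS _ (Sa j).
  have e : forall i, (if i == s j then n%:R * t j else 0) = (c i)%:R :> R.
    apply: (linearly_independent_inj fg).
    rewrite (bigD1 (s j)) //= eqxx big1 ?addr0; last first.
      by move=> i /negbTE->; rewrite scale0r.
    rewrite -scalerA -aE scaler_nat ac.
    by apply: eq_bigr => i _; rewrite scaler_nat.
  have := e (s j); rewrite eqxx => esj.
  exists (c (s j)), n; split.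
    by rewrite -(ltr0n R) -esj mulr_gt0 // ltr0n.
  by rewrite -scaler_nat -esj -scalerA -aE scaler_nat.
have /choice[p /choice[q pqE]] := pq.
move=> x Sx; have [n [c [n0 xc]]] := spS _ Sx.
(* The product of all [p j] clears every denominator at once; in the [j]-th term [p j] is absorbed
   by [q j]. *)
exists (n * \prod_j p j)%N,
  (fun j => q j * (\prod_(k | k != j) p k * c (s j)))%N; split.
  by rewrite muln_gt0 n0 prodn_gt0 // => j; have [] := pqE j.
rewrite mulrnA xc -sumrMnl reidx; apply: eq_bigr => j _.
have [_ e] := pqE j.
by rewrite [RHS]mulrnA -e -mulrnA -mulrnA (bigD1 j) //= mulnC mulnA.
Qed.

(** * The Apery set *)

(** Some [a i] is subtracted as long as the result stays in S; each subtraction lowers [coord_sum]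
    by at least 1. *)
Lemma apery_decomposition (R : realType) (d : nat) (S : set 'rV[R]_d)
    (a : 'I_d -> 'rV[R]_d) :
  S `<=` nat_vectors (d := d) -> (forall i, S (a i)) -> (forall i, a i != 0) ->
  forall x, S x -> exists w (c : 'I_d -> nat),
    apery S a w /\ x = w + \sum_i a i *+ c i.
Proof.
move=> SN Sa a0 x Sx.
have [n] : exists n : nat, coord_sum x < n%:R.
  by exists (Num.truncn (coord_sum x)).+1; apply: truncnS_gt.
elim: n x Sx => [|n IHn] x Sx xn.
  by move: xn; rewrite ltNge coord_sum_ge0 //; apply: SN.
have [[i Sxa]|nS] := pselect (exists i, S (x - a i)); last first.
  exists x, (fun=> 0%N); split; first by split=> // i Si; apply: nS; exists i.
  by rewrite big1 ?addr0.
have [|w [c [Aw xE]]] := IHn _ Sxa.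
  rewrite coord_sumD coord_sumN ltrBlDr (lt_le_trans xn) // -natr1 lerD2l.
  by apply: coord_sum_ge1 => //; apply: SN.
exists w, (fun k => (k == i) + c k)%N; split=> //.
under eq_bigr do rewrite mulrnDr.
rewrite big_split /= (bigD1 i) //= eqxx mulr1n big1 ?addr0; last first.
  by move=> k /negbTE ->; rewrite mulr0n.
by rewrite addrCA -xE addrC subrK.
Qed.

(** If [v *+ N v - a i] lies in S, an Apery element cannot use the generator [v] more than [N v]
    times, since [a i] could then be subtracted from it. *)
Lemma apery_bounded (R : realType) (d : nat) (S : set 'rV[R]_d)
    (a : 'I_d -> 'rV[R]_d) :
  affine_semigroup S -> (forall i, S (a i)) -> spans_up_to_multiple S a ->
  exists B : R, forall w, apery S a w -> coord_sum w <= B.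
Proof.
move=> [SN [G finG GS]] Sa spS.
have mS : submonoid S by rewrite -GS; apply: nat_span_submonoid.
have [s0 GE] := (finite_seqP G).1 finG.
pose s := undup s0.
have GE' : G = [set` s].
  by rewrite GE; apply/seteqP; split=> x /=; rewrite mem_undup.
have sS v : v \in s -> S v.
  by move=> sv; rewrite -GS; apply: nat_span_sub; rewrite GE'.
(* A positive multiple of [v] is an N-combination of the [a i] with a nonzero coefficient. The value
   0 is a default for [v] zero or outside S. *)
have exN v : exists N : nat, S v -> v != 0 -> exists i, S (v *+ N - a i).
  have [[Sv v0]|nS] := pselect (S v /\ v != 0); last first.
    by exists 0%N => Sv v0; case: nS.
  have [n [c [n0 vc]]] := spS _ Sv; exists n => _ _.
  have [i ci] : exists i, c i != 0%N.
    apply/existsP; apply: contraNT v0 => /existsPn c0.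
    have : v *+ n == 0.
      rewrite vc big1 // => i _.
      by have := c0 i; rewrite negbK => /eqP ->.
    by rewrite -scaler_nat scaler_eq0 pnatr_eq0 eqn0Ngt n0.
  exists i; rewrite vc (bigD1 i) //= -[c i]prednK ?lt0n // mulrS.
  rewrite -addrA [X in S X]addrC addKr; apply: mS.2; first exact: submonoid_mulrn.
  by apply: submonoid_sum => // k _ _; apply: submonoid_mulrn.
have [N NE] := choice exN.
exists (\sum_(v <- s) coord_sum v *+ N v) => w [Sw Aw].
have [c wE] : exists c : 'rV[R]_d -> nat, w = \sum_(v <- s) v *+ c v.
  by apply: nat_span_seq; rewrite ?undup_uniq // -GE' GS.
rewrite wE coord_sum_sum big_seq [X in _ <= X]big_seq.
apply: ler_sum => v sv; rewrite coord_sumMn.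
have [->|v0] := eqVneq v 0; first by rewrite coord_sum0 !mul0rn.
have Sv := sS v sv.
have [cN|Nc] := leqP (c v) (N v).
  by apply: ler_wpMn2l => //; apply: coord_sum_ge0; apply: SN.
have [i SNi] := NE v Sv v0.
case: (Aw i).
rewrite wE (bigD1_seq v) ?undup_uniq //= -(subnKC (ltnW Nc)) mulrnDr.
rewrite [X in S X](_ : _ = v *+ N v - a i +
  (v *+ (c v - N v) + \sum_(u <- s | u != v) u *+ c u)); last first.
  by rewrite [RHS]addrAC addrA.
apply: mS.2 => //; apply: mS.2; first exact: submonoid_mulrn.
by apply: submonoid_sum => // u su _; apply: submonoid_mulrn => //; apply: sS.
Qed.

(** Each strict step up in the order raises [coord_sum] by at least 1, while it stays below [B]; the
    induction is on the remaining gap. *)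
Lemma apery_le_maximal (R : realType) (d : nat) (S : set 'rV[R]_d)
    (a : 'I_d -> 'rV[R]_d) :
  affine_semigroup S -> (forall i, S (a i)) -> spans_up_to_multiple S a ->
  forall w, apery S a w ->
  exists2 m, maximal_elements S (apery S a) m & semigroup_le S w m.
Proof.
move=> affS Sa spS w Aw.
have [B AB] := apery_bounded affS Sa spS.
have [SN [G _ GS]] := affS.
have [S0 SD] : submonoid S by rewrite -GS; apply: nat_span_submonoid.
have [n] : exists n : nat, B - coord_sum w < n%:R.
  by exists (Num.truncn (B - coord_sum w)).+1; apply: truncnS_gt.
elim: n w Aw => [|n IHn] w Aw wn.
  by move: wn; rewrite ltNge subr_ge0 AB.
have [[y [Ay wy yw]]|nmax] :=
    pselect (exists y, [/\ apery S a y, semigroup_le S w y & y <> w]).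
  have [|m mm ym] := IHn y Ay.
    have := coord_sum_ge1 (SN _ wy).
    rewrite subr_eq0 => /(_ (introN eqP yw)).
    rewrite coord_sumD coord_sumN => le1.
    rewrite -(ltrD2r 1) natr1; apply: le_lt_trans wn.
    by rewrite -addrA lerD2l -lerBrDl opprK addrC.
  exists m => //; rewrite /semigroup_le -(subrK y m) -addrA.
  exact: SD.
exists w; last by rewrite /semigroup_le subrr.
split=> // y Ay wy; apply: contrapT => yw; apply: nmax; by exists y.
Qed.

(** * Normality and the parallelepiped *)

Lemma normal_apery_sub (R : realType) (d : nat) (S : set 'rV[R]_d)
    (a : 'I_d -> 'rV[R]_d) :
  (forall i, S (a i)) -> spans_up_to_multiple S a ->
  normal_semigroup S -> apery S a `<=` fundamental_parallelepiped a.
Proof.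
move=> Sa spS nS w [Sw Aw].
have [l l0 wE] := cone_nonneg_comb spS (sub_cone Sw).
exists l => // i; rewrite l0 ltNge; apply/negP => l1; apply: (Aw i).
rewrite nS; split; first by exists w, (a i).
(* Coordinates of [w - a i], nonnegative because [l i] is at least 1. *)
exists d, (fun k => l k - (k == i)%:R), a; split=> // [k|].
  by have [->|] := eqVneq k i; rewrite ?subr_ge0 ?subr0.
under eq_bigr do rewrite scalerBl.
rewrite sumrB -wE (bigD1 i) //= eqxx scale1r big1 ?addr0 //.
by move=> k /negbTE ->; rewrite scale0r.
Qed.

Lemma apery_sub_normal (R : realType) (d : nat) (S : set 'rV[R]_d)
    (a : 'I_d -> 'rV[R]_d) :
  S `<=` nat_vectors (d := d) -> submonoid S ->
  (forall i, S (a i)) -> (forall i, a i != 0) ->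
  linearly_independent a -> spans_up_to_multiple S a ->
  apery S a `<=` fundamental_parallelepiped a -> normal_semigroup S.
Proof.
move=> SN mS Sa a0 fa spS AP; apply/seteqP; split=> x.
  move=> Sx; split; last exact: sub_cone.
  by exists x, 0; rewrite subr0; split=> //; apply: mS.1.
move=> [[u [v [Su Sv xuv]]] /(cone_nonneg_comb spS)[l l0 xl]].
have [n [c [n0 vc]]] := spS _ Sv.
(* Adding [n.-1] copies of [v] to both terms of [u - v] makes the subtracted term [v *+ n], an
   N-combination of the [a i]. *)
have Su' : S (u + v *+ n.-1) by apply: mS.2 => //; apply: submonoid_mulrn.
have [w [e [Aw uE]]] := apery_decomposition SN Sa a0 Su'.
have [m m01 wE] := AP _ Aw.
have xE : x + \sum_i a i *+ c i = w + \sum_i a i *+ e i.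
  rewrite -vc -uE xuv -[in v *+ n](prednK n0) mulrS addrA subrK.
  by [].
have co i : l i + (c i)%:R = m i + (e i)%:R.
  apply: (linearly_independent_inj (l := fun i => l i + (c i)%:R)
    (m := fun i => m i + (e i)%:R) fa).
  under eq_bigr do rewrite scalerDl scaler_nat.
  under [RHS]eq_bigr do rewrite scalerDl scaler_nat.
  by rewrite !big_split /= -xl -wE.
(* Since [0 <= l i] and [m i < 1], the equality [co] gives [c i < e i + 1], and integrality
   concludes. *)
have ce i : (c i <= e i)%N.
  rewrite -ltnS -(ltr_nat R) -natr1 [ltRHS]addrC.
  apply: (@le_lt_trans _ _ (m i + (e i)%:R)); first by rewrite -co lerDr.
  by rewrite ltrD2r; have /andP[] := m01 i.
have -> : x = w + \sum_i a i *+ (e i - c i).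
  apply: (addIr (\sum_i a i *+ c i)); rewrite xE -addrA -big_split /=.
  by congr (_ + _); apply: eq_bigr => i _; rewrite -mulrnDr subnK.
by apply: mS.2; [case: Aw | apply: submonoid_nat_comb].
Qed.

Theorem theorem4p6 (R : realType) (d : nat) (d_gt0 : (0 < d)%N)
    (S : set 'rV[R]_d) (a : 'I_d -> 'rV[R]_d)
    (affS : affine_semigroup S) (simplS : simplicial S)
    (inj_a : injective a) (rays_a : range a = extremal_rays S) :
  [<-> normal_semigroup S;
       opp_set (quasi_frobenius S a) `<=` S `&` relint a;
       opp_set (quasi_frobenius S a) `<=` relint a;
       apery S a `<=` fundamental_parallelepiped a].
Proof.
have [SN [G _ GS]] := affS.
have mS : submonoid S by rewrite -GS; apply: nat_span_submonoid.
have [B [BS _] [g [Bg fg spg]]] := simplS.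
have Sg i : S (g i) by rewrite -BS; apply: nat_span_sub.
have ra i : extremal_rays S (a i) by rewrite -rays_a; exists i.
have Sa i : S (a i) by have [rho _ []] := ra i.
have a0 i : a i != 0 by have [rho _ []] := ra i.
have [fa spa] : linearly_independent a /\ spans_up_to_multiple S a.
  apply: (extremal_rays_basis Sg) => //.
  by apply: linearly_independent_over_reals => // i; apply: SN.
tfae.
- move=> nS _ [_ [w [Aw _] <-] <-].
  have [l l01 wE] := normal_apery_sub Sa spa nS Aw.
  have fE : - (w - \sum_i a i) = \sum_i (1 - l i) *: a i.
    under [RHS]eq_bigr do rewrite scalerBl scale1r.
    by rewrite sumrB -wE opprB.
  have l1 i : 0 < 1 - l i by rewrite subr_gt0; have /andP[] := l01 i.
  split; last by exists (fun i => 1 - l i).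
  (* Membership in S comes from normality: the element is a difference of elements of S with
     positive coordinates. *)
  rewrite nS; split.
    exists (\sum_i a i), w; split=> //; last by rewrite opprB.
      by apply: submonoid_sum.
    by case: Aw.
  by exists d, (fun i => 1 - l i), a; split=> // i; apply: ltW.
- by move=> h x /h[].
- move=> h w Aw.
  have [m mm wm] := apery_le_maximal affS Sa spa Aw.
  have [l l0 wE] := cone_nonneg_comb spa (sub_cone Aw.1).
  have [k k0 kE] := cone_nonneg_comb spa (sub_cone (wm : S (m - w))).
  have [|n n0 nE] := h (- (m - \sum_i a i)).
    by exists (m - \sum_i a i) => //; exists m.
  exists l => // i; rewrite l0 /=.
  (* The sum of the [a i] is [w] plus [m - w] plus the opposite of the quasi-Frobenius element of
     [m]; as [k i >= 0] and [n i > 0], this forces [l i < 1]. *)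
  have e1 : l i + k i + n i = 1.
    apply: (linearly_independent_inj (l := fun i => l i + k i + n i)
      (m := fun=> 1) fa).
    under eq_bigr do rewrite !scalerDl.
    rewrite !big_split /= -wE -kE -nE [w + _]addrC subrK opprB addrC subrK.
    by apply: eq_bigr => j _; rewrite scale1r.
  rewrite -e1 -addrA ltrDl; exact: ltr_wpDl.
- exact: apery_sub_normal.
Qed.
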